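(* Suppose that $f$ has the MLR property, i.e. $f(x_1-\eta_1)f(x_2-\eta_2)\ge f(x_1-\eta_2)f(x_2-\eta_1)$ whenever $x_1<x_2$ and $\eta_1<\eta_2$. Consider estimating $\theta_{(2)}$ under the squared error loss $(a-\theta_{(2)})^2$, and let $$c_0=\int_{-\infty}^{\infty}xf(x)\,dx,\qquad c(0,u)=\frac{\int_{-\infty}^{\infty}zf(z-u)f(z)\,dz}{\int_{-\infty}^{\infty}f(z-u)f(z)\,dz},\quad u>0.$$ If $P_{\boldsymbol\theta}(c_0>c(0,U))\ne0$ for some $\boldsymbol\theta\in\mathbb{R}^2$, then the estimator $\delta_{ST}(\mathbf X)=X_{(2)}-\min\{c_0,c(0,U)\}$ improves upon the estimator $\delta_{c_0}(\mathbf X)=X_{(2)}-c_0$.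
   Context: Setting: $f$ is a Lebesgue probability density on $\mathbb{R}$; $X_1,X_2$ are independent and $X_i$ has density $x\mapsto f(x-\theta_i)$, where $\boldsymbol\theta=(\theta_1,\theta_2)\in\mathbb{R}^2$ is unknown. Write $\theta_{(2)}=\max\{\theta_1,\theta_2\}$, $X_{(1)}=\min\{X_1,X_2\}$, $X_{(2)}=\max\{X_1,X_2\}$, $U=X_{(2)}-X_{(1)}$, $\mathbf X=(X_1,X_2)$. The risk of $\delta$ is $R(\boldsymbol\theta,\delta)=E_{\boldsymbol\theta}[(\delta(\mathbf X)-\theta_{(2)})^2]$. Standing assumptions: all integrals involving the loss are finite (so the risks are finite), and $c(0,u)$ is well defined for every $u>0$ (in particular $\int f(z-u)f(z)\,dz>0$). ''$\delta'$ improves upon $\delta$'' means $R(\boldsymbol\theta,\delta')\le R(\boldsymbol\theta,\delta)$ for all $\boldsymbol\theta\in\mathbb{R}^2$, with strict inequality for some $\boldsymbol\theta$. *)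

(* Defs.v *)
From HB Require Import structures.
From mathcomp Require Import all_boot all_order all_algebra.
From mathcomp Require Import all_classical all_reals all_analysis.

Set Implicit Arguments.
Unset Strict Implicit.
Unset Printing Implicit Defensive.

Import Order.TTheory GRing.Theory Num.Theory.
Import numFieldNormedType.Exports.

Local Open Scope classical_set_scope.
Local Open Scope ring_scope.

Section Densities.
Context {R : realType}.
Local Notation mu := (@lebesgue_measure R).

Definition is_density (f : R -> R) : Prop :=
  [/\ measurable_fun [set: R] f,
      (forall x, 0 <= f x) &
      (\int[mu]_x (f x)%:E = 1)%E].

Definition MLR (f : R -> R) : Prop :=
  forall x1 x2 eta1 eta2 : R, x1 < x2 -> eta1 < eta2 ->
    f (x1 - eta1) * f (x2 - eta2) >= f (x1 - eta2) * f (x2 - eta1).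

Definition c0 (f : R -> R) : R := \int[mu]_x (x * f x).

(* [Rintegral] is a total function and division by zero returns zero: the
   conditions under which [c0] and [c_0u] are the intended quantities are
   [c0_well_defined] and [c_0u_well_defined]. *)
Definition c_0u (f : R -> R) (u : R) : R :=
  (\int[mu]_z (z * f (z - u) * f z)) / (\int[mu]_z (f (z - u) * f z)).

Definition c0_well_defined (f : R -> R) : Prop :=
  mu.-integrable [set: R] (fun x => (x * f x)%:E).

Definition c_0u_well_defined (f : R -> R) (u : R) : Prop :=
  [/\ mu.-integrable [set: R] (fun z => (z * f (z - u) * f z)%:E),
      mu.-integrable [set: R] (fun z => (f (z - u) * f z)%:E) &
      0 < \int[mu]_z (f (z - u) * f z)].

End Densities.

Section RandomVariables.
Context {d : measure_display} {T : measurableType d} {R : realType}.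
Variable P : probability T R.

Definition has_density (X : {RV P >-> R}) (g : R -> R) : Prop :=
  forall A : set R, measurable A ->
    (distribution P X A = \int[@lebesgue_measure R]_(x in A) (g x)%:E)%E.

Definition independent_RV (X Y : {RV P >-> R}) : Prop :=
  forall A B : set R, measurable A -> measurable B ->
    (P (X @^-1` A `&` Y @^-1` B) = P (X @^-1` A) * P (Y @^-1` B))%E.

End RandomVariables.

(* The observation is (X1, X2) on a sample space T carrying one probability
   measure P theta for every parameter theta = (theta1, theta2). *)
Definition location_model {d : measure_display} {T : measurableType d}
    {R : realType} (f : R -> R) (P : R * R -> probability T R)
    (X1 X2 : {mfun T >-> R}) : Prop :=
  forall theta : R * R,
    [/\ @independent_RV d T R (P theta) X1 X2,
        @has_density d T R (P theta) X1 (fun x => f (x - theta.1)) &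
        @has_density d T R (P theta) X2 (fun x => f (x - theta.2))].

Section Estimators.
Context {R : realType}.

Definition pair_max (x : R * R) : R := Num.max x.1 x.2.
Definition pair_min (x : R * R) : R := Num.min x.1 x.2.
Definition spacing (x : R * R) : R := pair_max x - pair_min x.

Definition delta_c0 (f : R -> R) (x : R * R) : R := pair_max x - c0 f.

Definition delta_ST (f : R -> R) (x : R * R) : R :=
  pair_max x - Num.min (c0 f) (c_0u f (spacing x)).

End Estimators.

Section Risk.
Context {d : measure_display} {T : measurableType d} {R : realType}.
Variables (P : R * R -> probability T R) (X1 X2 : {mfun T >-> R}).
Local Open Scope ereal_scope.

Definition risk (theta : R * R) (delta : R * R -> R) : \bar R :=
  'E_(P theta)[fun w => ((delta (X1 w, X2 w) - pair_max theta) ^+ 2)%R].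

Definition improves_upon (delta' delta : R * R -> R) : Prop :=
  (forall theta, risk theta delta' <= risk theta delta) /\
  (exists theta, risk theta delta' < risk theta delta).

End Risk.

(* Main.v *)
Require Import Defs.
From HB Require Import structures.
From mathcomp Require Import all_boot all_order all_algebra.
From mathcomp Require Import all_classical all_reals all_analysis.
From mathcomp Require Import measurable_realfun ring lra.

Import Order.TTheory GRing.Theory Num.Theory.
Import numFieldNormedType.Exports.
Local Open Scope classical_set_scope.
Local Open Scope ring_scope.

(* Write Z = X_(2) - theta_(2), s(u) = min(c_0, c(0,u)) and w = c_0 - s. Since
   Z - c_0 = (Z - s(U)) - w(U), the risk of delta_c0 exceeds that of delta_ST by
   E[w(U)^2] - 2 E[w(U) (Z - s(U))], so it suffices that E[w(U) (Z - s(U))] <= 0.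
   With l = |theta_1 - theta_2|, the pair (Z, U) has on u > 0 the joint density
   g_l(z,u) = f(z+l) f(z-u) + f(z) f(z-u+l). MLR makes
   g_l / g_0 = (f(z+l)/f(z) + f(z-u+l)/f(z-u)) / 2 nonincreasing in z, hence
   E[Z | U = u] is at most its value c(0,u) at l = 0, and w(u) <> 0 forces
   s(u) = c(0,u). Positive and negative parts are kept apart throughout, so that
   only Tonelli's theorem is needed. *)

(** * Change of density and translation invariance for nonnegative integrals *)

Section Integration.
Import HBNNSimple.
Local Open Scope ereal_scope.

(** On indicators this is the hypothesis on [nu]; linearity carries it to simple functions, and
    monotone convergence on both sides carries it to [h]. *)
Lemma ge0_integral_density (d : measure_display) (T : measurableType d)
    (R : realType) (mu nu : {measure set T -> \bar R}) (g : T -> R)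
    (h : T -> \bar R) :
    measurable_fun [set: T] g -> (forall x, (0 <= g x)%R) ->
    (forall A, measurable A -> nu A = \int[mu]_(x in A) (g x)%:E) ->
    measurable_fun [set: T] h -> (forall x, 0 <= h x) ->
  \int[nu]_x h x = \int[mu]_x (h x * (g x)%:E).
Proof.
move=> mg g0 nuE mh h0.
have mgE : measurable_fun [set: T] (EFin \o g) by exact/measurable_EFinP.
pose s := nnsfun_approx measurableT mh.
have hs x : (EFin \o s n) x @[n --> \oo] --> h x.
  by apply: cvg_nnsfun_approx.
have nds x a b : (a <= b)%N -> (s a x)%:E <= (s b x)%:E.
  by move=> ab; rewrite lee_fin; exact/lefP/nd_nnsfun_approx.
transitivity (lim (\int[nu]_x (EFin \o s n) x @[n --> \oo])).
  rewrite -monotone_convergence//.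
  - by apply: eq_integral => x _; apply/esym/cvg_lim.
  - by move=> n; exact/measurable_EFinP.
  - by move=> n x _; rewrite lee_fin.
  - by move=> x _ a b; exact: nds.
transitivity (lim (\int[mu]_x ((s n x)%:E * (g x)%:E) @[n --> \oo])); last first.
  rewrite -monotone_convergence//.
  - by apply: eq_integral => x _; apply: cvg_lim => //; apply: cvgeZr => //; exact: hs.
  - by move=> n; apply: emeasurable_funM => //; exact/measurable_EFinP.
  - by move=> n x _; rewrite mule_ge0 ?lee_fin.
  - by move=> x _ a b ab; rewrite lee_wpmul2r ?lee_fin//; exact: nds.
suff E n : \int[nu]_x (EFin \o s n) x = \int[mu]_x ((s n x)%:E * (g x)%:E).
  by under eq_fun do rewrite E.
have mind r : measurable_fun [set: T]
    (fun x => (r * \1_(s n @^-1` [set r]) x)%:E).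
  by apply/measurable_EFinP; exact: measurable_funM.
transitivity (\int[nu]_x
    (\sum_(y \in range (s n)) (y * \1_(s n @^-1` [set y]) x)%:E)).
  by apply: eq_integral => x _ /=; rewrite fimfunE -fsumEFin.
rewrite ge0_integral_fsum//; last by move=> y x _; exact: nnfun_muleindic_ge0.
transitivity (\int[mu]_x (\sum_(y \in range (s n))
    ((y * \1_(s n @^-1` [set y]) x)%:E * (g x)%:E))); last first.
  apply: eq_integral => x _.
  rewrite -ge0_mule_fsuml => [|y]; last exact: nnfun_muleindic_ge0.
  by rewrite fsumEFin// -(fimfunE _ x).
rewrite ge0_integral_fsum//; last 2 first.
  - by move=> y; exact: emeasurable_funM.
  - by move=> y x _; apply: mule_ge0; [exact: nnfun_muleindic_ge0|rewrite lee_fin].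
apply: eq_fsbigr => r rs.
under eq_integral do rewrite EFinM.
rewrite integralZl_indic_nnsfun// integral_indic// setIT nuE//.
under [RHS]eq_integral do rewrite EFinM -muleA.
rewrite ge0_integralZl//.
- congr (_ * _); under [RHS]eq_integral do rewrite muleC.
  rewrite [LHS]integral_mkcond; apply: eq_integral => x _.
  by rewrite epatch_indic.
- by apply: emeasurable_funM => //; exact/measurable_EFinP.
- by move=> x _; rewrite mule_ge0 ?lee_fin.
- by move: rs; rewrite inE => -[t _ <-]; rewrite lee_fin.
Qed.

Context {R : realType}.
Local Notation mu := (@lebesgue_measure R).

(** Lebesgue measure is determined by its values on half-open intervals, whose length a shift
    preserves. *)
Lemma lebesgue_measureD (c : R) (A : set (measurableTypeR R)) : measurable A ->
  pushforward mu (+%R c : _ -> measurableTypeR R) A = mu A.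
Proof.
move=> mA.
have mc : measurable_fun [set: measurableTypeR R]
    (+%R c : _ -> measurableTypeR R) by exact: measurable_funD.
apply/esym/lebesgue_measure_unique => //= _ [[a b]] _ <-.
rewrite /pushforward /=.
rewrite (_ : _ @^-1` _ = `]a - c, b - c]%classic)%R; last first.
  by apply/seteqP; split => x /=; rewrite !in_itv/= ltrBlDl lerBrDl.
rewrite !lebesgue_measure_itv/= !lte_fin ltrD2r.
by case: ifP => // _; congr (_%:E); ring.
Qed.

Lemma ge0_integral_translation (c : R) (h : R -> \bar R) :
  measurable_fun [set: R] h -> (forall x, 0 <= h x) ->
  \int[mu]_x h (c + x)%R = \int[mu]_x h x.
Proof.
move=> mh h0.
have mc : measurable_fun [set: measurableTypeR R]
    (+%R c : _ -> measurableTypeR R) by exact: measurable_funD.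
rewrite -[LHS](@ge0_integral_pushforward _ _ _ _ _ _ mc mu setT h)//.
by apply: eq_measure_integral => A mA _; exact: lebesgue_measureD.
Qed.

End Integration.

(** * Plane integrals in the coordinates gap and maximum *)

Section PlaneIntegration.
Local Open Scope ereal_scope.
Context {R : realType}.
Local Notation mu := (@lebesgue_measure R).

Lemma measurable_if_lt (d : measure_display) (T : measurableType d)
    (a b : T -> R) (h : T -> \bar R) :
  measurable_fun [set: T] a -> measurable_fun [set: T] b ->
  measurable_fun [set: T] h ->
  measurable_fun [set: T] (fun x => if (a x < b x)%R then h x else 0).
Proof.
move=> ma mb mh; apply: measurable_fun_ifT => //.
exact: measurable_fun_ltr.
Qed.

(** Put [y = x + u], exchange the integrals by Tonelli, then put [x = z - u]: [z] is the larger
    coordinate and [u] the gap. *)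
Lemma ge0_integral_above_diagonal (H : R * R -> \bar R) :
  measurable_fun [set: R * R] H -> (forall p, 0 <= H p) ->
  \int[mu]_x \int[mu]_y (if (x < y)%R then H (x, y) else 0) =
  \int[mu]_u \int[mu]_z (if (0 < u)%R then H (z - u, z)%R else 0).
Proof.
move=> mH H0.
pose K (p : R * R) := if (p.1 < p.2)%R then H p else 0.
have mK : measurable_fun [set: R * R] K by exact: measurable_if_lt.
have K0 p : 0 <= K p by rewrite /K; case: ifP.
have mKshift : measurable_fun [set: R * R] (fun p => K (p.1, p.1 + p.2)%R).
  apply: (measurableT_comp mK); apply: measurable_fun_pair => //.
  exact: measurable_funD.
transitivity (\int[mu]_x \int[mu]_u K (x, x + u)%R).
  apply: eq_integral => x _.
  rewrite (ge0_integral_translation x (fun y => K (x, y)))//.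
  exact: measurableT_comp.
transitivity (\int[mu]_u \int[mu]_x K (x, x + u)%R).
  exact: (@fubini_tonelli _ _ _ _ R mu mu
    (fun p : R * R => K (p.1, p.1 + p.2)%R)).
apply: eq_integral => u _.
rewrite -(ge0_integral_translation (- u) (fun x => K (x, x + u)%R))//; last first.
  apply: (measurableT_comp mK); apply: measurable_fun_pair => //.
  exact: measurable_funD.
apply: eq_integral => z _.
by rewrite /K/= addrC addrNK ltrBlDr ltrDl addrC.
Qed.

(** The plane is cut along the diagonal and the lower half is reflected onto the upper one; the two
    summands are the two orderings of a pair with maximum [z] and gap [u]. *)
Lemma ge0_integral_plane (H : R * R -> \bar R) :
  measurable_fun [set: R * R] H -> (forall p, 0 <= H p) ->
  \int[mu]_x \int[mu]_y H (x, y) =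
  \int[mu]_u \int[mu]_z
    (if (0 < u)%R then H (z - u, z)%R + H (z, z - u)%R else 0).
Proof.
move=> mH H0.
pose Hs (p : R * R) := H (p.2, p.1).
have mHs : measurable_fun [set: R * R] Hs.
  by apply: (measurableT_comp mH); exact: measurable_fun_pair.
pose K (p : R * R) := if (p.1 < p.2)%R then H p else 0.
pose L (p : R * R) := if (p.2 < p.1)%R then H p else 0.
have mK : measurable_fun [set: R * R] K by exact: measurable_if_lt.
have mL : measurable_fun [set: R * R] L by exact: measurable_if_lt.
have K0 p : 0 <= K p by rewrite /K; case: ifP.
have L0 p : 0 <= L p by rewrite /L; case: ifP.
transitivity (\int[mu]_x (\int[mu]_y K (x, y) + \int[mu]_y L (x, y))).
  apply: eq_integral => x _.
  have m1 (G : R * R -> \bar R) : measurable_fun [set: R * R] G ->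
      measurable_fun [set: R] (fun y => G (x, y)).
    by move=> mG; exact: measurableT_comp.
  rewrite -ge0_integralD//; [|exact: m1..].
  (* [K + L] can differ from [H] only on the diagonal, so for fixed [x] the null point [y = x] is
     removed. *)
  rewrite -(@integral_setD1 R _ x setT); last 2 first.
  - exact: measurableD.
  - by apply: measurable_funTS; exact: m1.
  rewrite -[RHS](@integral_setD1 R _ x setT); last 2 first.
  - exact: measurableD.
  - by apply: measurable_funTS; apply: emeasurable_funD; exact: m1.
  apply: eq_integral => y; rewrite inE => -[_ /eqP yx].
  by rewrite /K /L/=; case: ltgtP yx => //; rewrite ?addr0 ?add0r ?adde0 ?add0e.
rewrite ge0_integralD//; last 4 first.
- by move=> x _; exact: integral_ge0.
- exact: (@measurable_fun_fubini_tonelli_F _ _ _ _ R mu K).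
- by move=> x _; exact: integral_ge0.
- exact: (@measurable_fun_fubini_tonelli_F _ _ _ _ R mu L).
rewrite (@fubini_tonelli _ _ _ _ R mu mu L)//=.
rewrite (ge0_integral_above_diagonal H)//.
(* Renaming the variables turns the part below the diagonal into the part above it for the reflected
   integrand [Hs]. *)
have -> : \int[mu]_y \int[mu]_x L (x, y) =
   \int[mu]_x \int[mu]_y (if (x < y)%R then Hs (x, y) else 0) by [].
rewrite (ge0_integral_above_diagonal Hs)//=; last by move=> p; exact: H0.
pose K' (p : R * R) := if (0 < p.1)%R then H (p.2 - p.1, p.2)%R else 0.
pose L' (p : R * R) := if (0 < p.1)%R then H (p.2, p.2 - p.1)%R else 0.
have mB : measurable_fun [set: R * R] (fun p => p.2 - p.1)%R.
  exact: measurable_funB.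
have mK' : measurable_fun [set: R * R] K'.
  apply: measurable_if_lt => //.
  by apply: (measurableT_comp mH); exact: measurable_fun_pair.
have mL' : measurable_fun [set: R * R] L'.
  apply: measurable_if_lt => //.
  by apply: (measurableT_comp mH); exact: measurable_fun_pair.
have K'0 p : 0 <= K' p by rewrite /K'; case: ifP.
have L'0 p : 0 <= L' p by rewrite /L'; case: ifP.
rewrite -ge0_integralD//; last 4 first.
- by move=> x _; apply: integral_ge0 => y _; exact: (K'0 (x, y)).
- exact: (@measurable_fun_fubini_tonelli_F _ _ _ _ R mu K').
- by move=> x _; apply: integral_ge0 => y _; exact: (L'0 (x, y)).
- exact: (@measurable_fun_fubini_tonelli_F _ _ _ _ R mu L').
apply: eq_integral => u _; rewrite -ge0_integralD//; last 4 first.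
- by move=> z _; exact: (K'0 (u, z)).
- by have := measurableT_comp mK' (pair1_measurable u).
- by move=> z _; exact: (L'0 (u, z)).
- by have := measurableT_comp mL' (pair1_measurable u).
by apply: eq_integral => z _; case: ifP; rewrite // adde0.
Qed.

End PlaneIntegration.

(** * Law of an independent pair *)

Section JointLaw.
Local Open Scope ereal_scope.
Context {d : measure_display} {T : measurableType d} {R : realType}.
Local Notation mu := (@lebesgue_measure R).

(** By independence the law of the pair agrees with the product measure on rectangles, hence
    everywhere by uniqueness of the product measure; Tonelli then gives the iterated integral. *)
Lemma ge0_integral_independent (d1 d2 : measure_display)
    (T1 : measurableType d1) (T2 : measurableType d2)
    (P : probability T R) (X : {mfun T >-> T1}) (Y : {mfun T >-> T2})
    (h : T1 * T2 -> \bar R) :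
    (forall A B, measurable A -> measurable B ->
      P (X @^-1` A `&` Y @^-1` B) = P (X @^-1` A) * P (Y @^-1` B)) ->
    measurable_fun [set: T1 * T2] h -> (forall p, 0 <= h p) ->
  \int[P]_w h (X w, Y w) =
  \int[distribution P X]_x \int[distribution P Y]_y h (x, y).
Proof.
move=> indep mh h0.
have mXY : measurable_fun [set: T] (fun w => (X w, Y w)).
  exact: measurable_fun_pair.
rewrite -[LHS](@ge0_integral_pushforward _ _ _ _ _ _ mXY P setT h)//.
rewrite -[RHS](@fubini_tonelli1 _ _ _ _ R
  (distribution P X) (distribution P Y) h)//.
apply: eq_measure_integral => A mA _; apply/esym.
by apply: product_measure_unique => // B C mB mC; exact: indep.
Qed.

Lemma ge0_integral_joint_density (P : probability T R) (X Y : {mfun T >-> R})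
    (f g : R -> R) (h : R * R -> \bar R) :
    @independent_RV d T R P X Y ->
    @has_density d T R P X f -> @has_density d T R P Y g ->
    measurable_fun [set: R] f -> (forall x, (0 <= f x)%R) ->
    measurable_fun [set: R] g -> (forall x, (0 <= g x)%R) ->
    measurable_fun [set: R * R] h -> (forall p, 0 <= h p) ->
  \int[P]_w h (X w, Y w) =
  \int[mu]_x \int[mu]_y (h (x, y) * (f x * g y)%:E).
Proof.
move=> indep Xf Yg mf f0 mg g0 mh h0.
(* [lebesgue_measure] lives on [measurableTypeR R], whose display differs from
   that of [R], so the laws of [X] and [Y] are taken there too. *)
have mX : measurable_fun [set: T] (X : T -> measurableTypeR R).
  exact: (measurable_funPT X).
have mY : measurable_fun [set: T] (Y : T -> measurableTypeR R).
  exact: (measurable_funPT Y).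
pose X' : {mfun T >-> measurableTypeR R} :=
  HB.pack (X : T -> measurableTypeR R) (isMeasurableFun.Build _ _ _ _ _ mX).
pose Y' : {mfun T >-> measurableTypeR R} :=
  HB.pack (Y : T -> measurableTypeR R) (isMeasurableFun.Build _ _ _ _ _ mY).
rewrite [LHS](ge0_integral_independent _ _ _ _ P X' Y' h indep mh h0).
have mhg : measurable_fun [set: R * R] (fun p : R * R => h p * (g p.2)%:E).
  apply: emeasurable_funM => //; apply/measurable_EFinP.
  exact: measurableT_comp.
have hg0 p : 0 <= h p * (g p.2)%:E by rewrite mule_ge0 ?lee_fin.
transitivity (\int[distribution P X']_x \int[mu]_y (h (x, y) * (g y)%:E)).
  apply: eq_integral => x _.
  apply: (ge0_integral_density _ _ _ mu (distribution P Y') g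
    (fun y => h (x, y))) => //.
  exact: (measurableT_comp mh (pair1_measurable x)).
rewrite (ge0_integral_density _ _ _ mu (distribution P X') f)//; last 2 first.
- exact: (@measurable_fun_fubini_tonelli_F _ _ _ _ R mu
    (fun p : R * R => h p * (g p.2)%:E)).
- by move=> x; apply: integral_ge0 => y _; exact: (hg0 (x, y)).
apply: eq_integral => x _.
rewrite -ge0_integralZr//.
- by apply: eq_integral => y _; rewrite EFinM -muleA (muleC (g y)%:E).
- exact: (measurableT_comp mhg (pair1_measurable x)).
- exact: f0.
Qed.

End JointLaw.

(** * Joint density of the centred maximum and the spacing *)

Section SpacingDensity.
Context {R : realType}.
Local Notation mu := (@lebesgue_measure R).

(* With [l = |theta_1 - theta_2|], this is the joint density at [(z, u)], [u > 0],
   of [X_(2) - theta_(2)] and [U]. *)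
Definition spacing_density (f : R -> R) (l u z : R) : R :=
  f (z + l) * f (z - u) + f z * f (z - u + l).

Lemma spacing_density_ge0 (f : R -> R) (l u z : R) :
  (forall x, 0 <= f x) -> 0 <= spacing_density f l u z.
Proof. by move=> f0; rewrite addr_ge0// mulr_ge0. Qed.

(** On the left, the first observation is the smaller one in the first summand and the larger one in
    the second. Exchanging [a] and [b] exchanges the summands, so only their distance matters. *)
Lemma spacing_densityE (f : R -> R) (a b u z : R) :
  f (Num.max a b + z - u - a) * f (Num.max a b + z - b) +
  f (Num.max a b + z - a) * f (Num.max a b + z - u - b) =
  spacing_density f `|a - b| u z.
Proof.
rewrite /spacing_density; have [ab|ba] := leP a b.
  rewrite ler0_norm ?subr_le0// opprB.
  have -> : b + z - u - a = z - u + (b - a) by ring.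
  have -> : b + z - a = z + (b - a) by ring.
  have -> : b + z - u - b = z - u by ring.
  by have -> : b + z - b = z; ring.
rewrite gtr0_norm ?subr_gt0//.
have -> : a + z - u - b = z - u + (a - b) by ring.
have -> : a + z - b = z + (a - b) by ring.
have -> : a + z - u - a = z - u by ring.
by have -> : a + z - a = z; ring.
Qed.

Lemma measurable_fun_app (d : measure_display) (T : measurableType d)
    (f : R -> R) (a : T -> R) :
  measurable_fun [set: R] f -> measurable_fun [set: T] a ->
  measurable_fun [set: T] (fun x => f (a x)).
Proof. by move=> mf ma; exact: (measurableT_comp mf ma). Qed.

Lemma measurable_spacing_density (d : measure_display) (T : measurableType d)
    (f : R -> R) (l : R) (u z : T -> R) :
  measurable_fun [set: R] f ->
  measurable_fun [set: T] u -> measurable_fun [set: T] z ->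
  measurable_fun [set: T] (fun x => spacing_density f l (u x) (z x)).
Proof.
move=> mf mtu mz; have mzu := measurable_funB mz mtu.
by apply: measurable_funD; apply: measurable_funM;
  apply: measurable_fun_app => //; exact: measurable_funD.
Qed.

Lemma measurable_pair_max : measurable_fun [set: R * R] (@pair_max R).
Proof. exact: measurable_maxr. Qed.

Lemma measurable_spacing : measurable_fun [set: R * R] (@spacing R).
Proof.
apply: measurable_funB; first exact: measurable_pair_max.
exact: measurable_minr.
Qed.

(** This turns the expectations to be compared into integrals over [u] and [z], so that each value
    [u] of the spacing can be treated on its own. *)
Lemma ge0_expectation_location (d : measure_display) (T : measurableType d)
    (f : R -> R) (P : R * R -> probability T R) (X1 X2 : {mfun T >-> R})
    (theta : R * R) (k : R * R -> R) :
    measurable_fun [set: R] f -> (forall x, 0 <= f x) ->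
    location_model f P X1 X2 ->
    measurable_fun [set: R * R] k -> (forall p, 0 <= k p) ->
  (\int[P theta]_w (k (pair_max (X1 w, X2 w) - pair_max theta,
                       spacing (X1 w, X2 w)))%:E =
   \int[mu]_u \int[mu]_z
     (if (0 < u)%R then
        (k (z, u) * spacing_density f `|theta.1 - theta.2| u z)%:E
      else 0))%E.
Proof.
move=> mf f0 model mk k0.
have [indep d1 d2] := model theta.
set m := pair_max theta; set l := `|_|.
pose h (p : R * R) := (k (pair_max p - m, spacing p))%:E.
have mh : measurable_fun [set: R * R] h.
  apply/measurable_EFinP; apply: (measurableT_comp mk).
  apply: measurable_fun_pair; last exact: measurable_spacing.
  by apply: measurable_funB => //; exact: measurable_pair_max.
have h0 p : (0 <= h p)%E by rewrite lee_fin.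
have ms t : measurable_fun [set: R] (fun x => f (x - t)).
  by apply: measurable_fun_app => //; exact: measurable_funB.
rewrite [LHS](ge0_integral_joint_density _ X1 X2 _ _ h indep d1 d2)//.
pose H (p : R * R) := (h p * (f (p.1 - theta.1) * f (p.2 - theta.2))%:E)%E.
have mH : measurable_fun [set: R * R] H.
  apply: emeasurable_funM => //; apply/measurable_EFinP.
  by apply: measurable_funM; apply: measurable_fun_app => //;
    exact: measurable_funB.
have H0 p : (0 <= H p)%E by rewrite mule_ge0// lee_fin mulr_ge0.
apply: etrans (ge0_integral_plane H mH H0) _.
apply: eq_integral => u _; have [u0|u0] := ltP; last by [].
have mF : measurable_fun [set: R] (fun z => H (z - u, z)%R + H (z, z - u)%R)%E.
  have mB : measurable_fun [set: R] (fun z => z - u) by exact: measurable_funB.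
  by apply: emeasurable_funD; apply: (measurableT_comp mH);
    exact: measurable_fun_pair.
(* The larger observation is replaced by its excess over the larger parameter [m]. *)
rewrite -(ge0_integral_translation m _ mF); last by move=> z; rewrite adde_ge0.
apply: eq_integral => z _.
rewrite /H /h /pair_max /spacing /pair_max /pair_min/=.
have lt_u (a : R) : a - u < a by lra.
rewrite !(max_l (ltW (lt_u _))) !(max_r (ltW (lt_u _))).
rewrite !(min_l (ltW (lt_u _))) !(min_r (ltW (lt_u _))).
rewrite -(spacing_densityE f theta.1 theta.2 u z) -/(pair_max theta) -/m.
rewrite opprB (addrC m z) addrK (addrC _ (u - _)) addrNK.
by rewrite -!EFinM -EFinD -mulrDr.
Qed.

End SpacingDensity.

(** * Means under a monotone likelihood ratio *)

Section ConditionalMean.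
Context {R : realType}.
Local Notation mu := (@lebesgue_measure R).

(* The hypothesis on [K] says that [c] is the mean of the law with density
   proportional to [h]. Multiplying both sides by [K], rather than comparing [g / h]
   with its value at [c], avoids the quotient and any integrability of [g]. *)
Lemma monotone_likelihood_ratio_mean (g h : R -> R) (c : R) :
    measurable_fun [set: R] g -> measurable_fun [set: R] h ->
    (forall x, 0 <= g x) -> (forall x, 0 <= h x) ->
    (forall x y, x < y -> g y * h x <= g x * h y) ->
    let K := (\int[mu]_z (Num.max 0 (c - z) * h z)%:E)%E in
    K = (\int[mu]_z (Num.max 0 (z - c) * h z)%:E)%E -> (0 < K < +oo)%E ->
  (\int[mu]_z (Num.max 0 (z - c) * g z)%:E <=
   \int[mu]_z (Num.max 0 (c - z) * g z)%:E)%E.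
Proof.
move=> mg mh g0 h0 mlr K KE /andP[K0 Koo].
have Kfin : K \is a fin_num by rewrite ge0_fin_numE// ltW.
have a0 z : 0 <= Num.max 0 (c - z) by rewrite le_max lexx.
have b0 z : 0 <= Num.max 0 (z - c) by rewrite le_max lexx.
have ma : measurable_fun [set: R] (fun z => Num.max 0 (c - z)).
  by apply: measurable_maxr => //; exact: measurable_funB.
have mb : measurable_fun [set: R] (fun z => Num.max 0 (z - c)).
  by apply: measurable_maxr => //; exact: measurable_funB.
have mM (p q : R -> R) : measurable_fun [set: R] p ->
    measurable_fun [set: R] q ->
    measurable_fun [set: R] (fun z => (p z * q z)%:E).
  by move=> mp mq; apply/measurable_EFinP; exact: measurable_funM.
(* The factor [K] is read as the integral below [c] on the left and, by [KE], as the one above [c]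
   on the right. Both sides become double integrals with weight [max 0 (y - c) * max 0 (c - x)], of
   [g y * h x] and of [g x * h y]. *)
rewrite -(@lee_pmul2l _ K)//.
rewrite -ge0_integralZl//; last 3 first.
- exact: mM.
- by move=> z _; rewrite lee_fin mulr_ge0.
- exact: ltW.
rewrite [in leRHS]KE muleC -ge0_integralZl//; last 3 first.
- exact: mM.
- by move=> z _; rewrite lee_fin mulr_ge0.
- by apply: integral_ge0 => z _; rewrite lee_fin mulr_ge0.
apply: ge0_le_integral => //.
- by move=> z _; rewrite mule_ge0 ?lee_fin ?mulr_ge0// ltW.
- by apply: emeasurable_funM => //; exact: mM.
- by apply: emeasurable_funM => //; exact: mM.
move=> y _; rewrite muleC [leRHS]muleC.
rewrite -[leLHS]ge0_integralZl//; last 3 first.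
- exact: mM.
- by move=> z _; rewrite lee_fin mulr_ge0.
- by rewrite lee_fin mulr_ge0.
rewrite -[leRHS]ge0_integralZl//; last 3 first.
- exact: mM.
- by move=> z _; rewrite lee_fin mulr_ge0.
- by rewrite lee_fin mulr_ge0.
apply: ge0_le_integral => //.
- by move=> z _; rewrite mule_ge0 ?lee_fin ?mulr_ge0.
- by apply: emeasurable_funM => //; exact: mM.
- by apply: emeasurable_funM => //; exact: mM.
move=> x _; rewrite -!EFinM lee_fin.
(* Unless [x < c < y], both sides vanish; in that case the likelihood ratio hypothesis applies to
   [x < y]. *)
have [cy|yc] := ltP c y; last first.
  by rewrite (@max_l _ _ 0 (y - c)) ?subr_le0// !(mul0r, mulr0).
have [xc|cx] := ltP x c; last first.
  by rewrite (@max_l _ _ 0 (c - x)) ?subr_le0// !(mul0r, mulr0).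
rewrite (_ : _ * g y * _ =
    Num.max 0 (y - c) * Num.max 0 (c - x) * (g y * h x)); last by ring.
rewrite (_ : _ * (_ * g x) =
    Num.max 0 (y - c) * Num.max 0 (c - x) * (g x * h y)); last by ring.
by rewrite ler_wpM2l ?mulr_ge0// mlr// (lt_trans xc).
Qed.

(** The equality says that the first moment about the mean [c] vanishes. If [K] were zero, the
    integral of the absolute value of [(z - c) * h z] would be zero as well, so [h] would vanish
    almost everywhere, against its positive mass. *)
Lemma centered_integral_parts (h : R -> R) :
    (forall x, 0 <= h x) ->
    mu.-integrable [set: R] (fun z => (z * h z)%:E) ->
    mu.-integrable [set: R] (fun z => (h z)%:E) ->
    0 < \int[mu]_z h z ->
    let c := (\int[mu]_z (z * h z)) / (\int[mu]_z h z) in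
    let K := (\int[mu]_z (Num.max 0 (c - z) * h z)%:E)%E in
  K = (\int[mu]_z (Num.max 0 (z - c) * h z)%:E)%E /\ (0 < K < +oo)%E.
Proof.
move=> h0 izh ih D0 c K.
pose q z := ((z - c) * h z)%:E.
have qE : q = (fun z => (z * h z)%:E - (c * h z)%:E)%E.
  by apply/funext => z; rewrite /q mulrBl EFinB.
have ich : mu.-integrable [set: R] (fun z => (c * h z)%:E).
  by have := integrableZl measurableT c ih.
have iq : mu.-integrable [set: R] q by rewrite qE; exact: integrableB.
have qp : (\int[mu]_z (Num.max 0 (z - c) * h z)%:E = \int[mu]_z q^\+ z)%E.
  apply: eq_integral => z _; rewrite funeposE /q -EFin_max; congr EFin.
  by rewrite maxr_pMl// mul0r maxC.
have qn : (K = \int[mu]_z q^\- z)%E.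
  apply: eq_integral => z _; rewrite funenegE /q -EFinN -EFin_max; congr EFin.
  by rewrite maxr_pMl// mul0r maxC -mulNr opprB.
have q0 : (\int[mu]_z q z = 0)%E.
  rewrite qE integralB//.
  have -> : (\int[mu]_z (c * h z)%:E = c%:E * \int[mu]_z (h z)%:E)%E.
    by rewrite -integralZl//.
  rewrite -(fineK (integrable_fin_num measurableT izh)).
  rewrite -(fineK (integrable_fin_num measurableT ih)) -EFinM -EFinB.
  by rewrite /c /Rintegral divfK ?subrr// gt_eqF.
have nfin : (\int[mu]_z q^\- z \is a fin_num)%E by exact: integrable_neg_fin_num.
have pfin : (\int[mu]_z q^\+ z \is a fin_num)%E by exact: integrable_pos_fin_num.
have eqpn : (\int[mu]_z q^\+ z = \int[mu]_z q^\- z)%E.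
  by move: q0; rewrite integralE => /eqP; rewrite sube_eq ?add0e// => /eqP.
split; first by rewrite qp qn.
have K0 : (0 <= K)%E.
  by apply: integral_ge0 => z _; rewrite lee_fin mulr_ge0// le_max lexx.
apply/andP; split; last by rewrite qn; move: nfin; rewrite fin_numE -ltey => /andP[].
rewrite lt_neqAle K0 andbT; apply/negP => /eqP K0'.
have mq := measurable_int _ iq.
have qabs : (\int[mu]_z `|q z| = 0)%E.
  transitivity (\int[mu]_z (q^\+ z + q^\- z))%E.
    by apply: eq_integral => z _; rewrite -[LHS]/((abse \o q) z) fune_abse.
  rewrite ge0_integralD//; last 2 first.
  - exact: measurable_funepos.
  - exact: measurable_funeneg.
  by rewrite eqpn -qn -K0' adde0.
(* The zero [c] of the factor [z - c] is removed so that this factor can be cancelled; a null point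
   does not affect the mass of [h]. *)
have mD : measurable ([set: R] `\ c) by exact: measurableD.
have mh : measurable_fun [set: R] (fun z => (h z)%:E) by exact: measurable_int ih.
have qae : ae_eq mu [set: R] q (cst 0%E) by exact/ae_eq_integral_abs.
have hae : ae_eq mu ([set: R] `\ c) (fun z => (h z)%:E) (cst 0%E).
  apply: filterS qae => z qz [_ zc]; move: (qz I) => /= -[/eqP].
  by rewrite mulf_eq0 subr_eq0 => /orP[/eqP /zc//|/eqP ->].
have : (\int[mu]_(z in [set: R] `\ c) `|(h z)%:E| = 0)%E.
  by apply/ae_eq_integral_abs => //; exact: measurable_funTS.
rewrite integral_setD1//; last first.
  by apply: measurable_funTS; exact: measurableT_comp.
under eq_integral do rewrite gee0_abs ?lee_fin//.
by move=> hint; move: D0; rewrite /Rintegral hint/= ltxx.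
Qed.

End ConditionalMean.

(** * Measurability of c(0,u) and the mean of the centred maximum given the spacing *)

Section Improvement.
Context {R : realType}.
Local Notation mu := (@lebesgue_measure R).

(** Tonelli gives measurability for the positive and negative parts separately; their extended real
    difference is measurable, and so is its image under [fine]. *)
Lemma measurable_Rintegral_param (q : R * R -> R) :
  measurable_fun [set: R * R] q ->
  measurable_fun [set: R] (fun u => \int[mu]_z q (u, z)).
Proof.
move=> mq.
have mqE : measurable_fun [set: R * R] (EFin \o q) by exact/measurable_EFinP.
have m1 := @measurable_fun_fubini_tonelli_F _ _ _ _ R mu ((EFin \o q)^\+)%E
  (measurable_funepos mqE) (fun=> funepos_ge0 _ _).
have m2 := @measurable_fun_fubini_tonelli_F _ _ _ _ R mu ((EFin \o q)^\-)%E
  (measurable_funeneg mqE) (fun=> funeneg_ge0 _ _).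
have mI : measurable_fun [set: R] (fun u => \int[mu]_z (q (u, z))%:E)%E.
  apply: eq_measurable_fun (emeasurable_funB m1 m2) => u _.
  rewrite [RHS]integralE /fubini_F.
  by congr (_ - _)%E; apply: eq_integral => z _; rewrite ?funeposE ?funenegE.
exact: (measurableT_comp (@fine_measurable R setT measurableT) mI).
Qed.

Lemma measurable_c_0u (f : R -> R) :
  measurable_fun [set: R] f -> (forall x, 0 <= f x) ->
  measurable_fun [set: R] (c_0u f).
Proof.
move=> mf f0.
have mfu : measurable_fun [set: R * R] (fun p => f (p.2 - p.1)).
  by apply: measurable_fun_app => //; exact: measurable_funB.
have mfz : measurable_fun [set: R * R] (fun p => f p.2).
  by apply: measurable_fun_app.
apply: measurable_funM.
  apply: (measurable_Rintegral_param (fun p => p.2 * f (p.2 - p.1) * f p.2)).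
  by apply: measurable_funM => //; exact: measurable_funM.
pose D (u : R) := \int[mu]_z (f (z - u) * f z).
have mD : measurable_fun [set: R] D.
  apply: (measurable_Rintegral_param (fun p => f (p.2 - p.1) * f p.2)).
  exact: measurable_funM.
(* The inverse is written as the power [-1], with which it agrees on nonnegative reals, both being 0
   at 0. *)
apply: (@eq_measurable_fun _ _ _ _ _ (fun u => D u `^ (-1))) => [u _|].
  by rewrite powR_inv1// Rintegral_ge0// => z _; rewrite mulr_ge0.
exact: (measurableT_comp (@measurable_powR R (-1)) mD).
Qed.

(** This is [MLR] at the shifts [- l] and [0]; since [MLR] asks for distinct shifts, [l = 0] is
    settled separately. *)
Lemma MLR_shift (f : R -> R) (l x y : R) : MLR f -> 0 <= l -> x < y ->
  f (y + l) * f x <= f (x + l) * f y.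
Proof.
move=> fmlr; rewrite le_eqVlt => /orP[/eqP <- _|l0 xy].
  by rewrite !addr0 mulrC.
have := fmlr x y (- l) 0 xy; rewrite oppr_lt0 => /(_ l0).
by rewrite !opprK !subr0 [f (y + l) * _]mulrC.
Qed.

(** Divided by [f (z - u) * f z], the spacing density is a sum of two ratios of the kind in
    [MLR_shift], at [z] and at [z - u]. Each is compared in cross-multiplied form. *)
Lemma MLR_spacing_density (f : R -> R) (l u x y : R) :
  (forall x, 0 <= f x) -> MLR f -> 0 <= l -> x < y ->
  spacing_density f l u y * (f (x - u) * f x) <=
  spacing_density f l u x * (f (y - u) * f y).
Proof.
move=> f0 fmlr l0 xy; rewrite /spacing_density !mulrDl lerD//.
  rewrite (_ : _ * _ = f (y - u) * f (x - u) * (f (y + l) * f x)); last by ring.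
  rewrite (_ : _ * (_ * f y) =
    f (y - u) * f (x - u) * (f (x + l) * f y)); last by ring.
  by rewrite ler_wpM2l ?mulr_ge0// MLR_shift.
rewrite (_ : _ * _ = f y * f x * (f (y - u + l) * f (x - u))); last by ring.
rewrite (_ : _ * (_ * f y) =
    f y * f x * (f (x - u + l) * f (y - u))); last by ring.
by rewrite ler_wpM2l ?mulr_ge0// MLR_shift// ltrD2r.
Qed.

(** [c_0u f u] is the mean for the density proportional to [f (z - u) * f z], which is half the
    spacing density at [l = 0]. Passing from [0] to [l] tilts the density towards smaller [z], so
    the mean excess over that point is at most zero. *)
Lemma spacing_density_mean_le (f : R -> R) (l u : R) :
    measurable_fun [set: R] f -> (forall x, 0 <= f x) -> MLR f -> 0 <= l ->
    c_0u_well_defined f u ->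
  (\int[mu]_z (Num.max 0 (z - c_0u f u) * spacing_density f l u z)%:E <=
   \int[mu]_z (Num.max 0 (c_0u f u - z) * spacing_density f l u z)%:E)%E.
Proof.
move=> mf f0 fmlr l0 [izh ih D0].
have mfu : measurable_fun [set: R] (fun z => f (z - u)).
  by apply: measurable_fun_app => //; exact: measurable_funB.
pose h z := f (z - u) * f z.
have h0 z : 0 <= h z by rewrite mulr_ge0.
have izh' : mu.-integrable [set: R] (fun z => (z * h z)%:E).
  by apply: eq_integrable izh => // z _; rewrite mulrA.
have cE : c_0u f u = (\int[mu]_z (z * h z)) / (\int[mu]_z h z).
  by congr (_ / _); apply: eq_Rintegral => z _; rewrite mulrA.
have [KE K0] := centered_integral_parts h h0 izh' ih D0.
rewrite -cE in KE K0.
have msd : measurable_fun [set: R] (spacing_density f l u).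
  exact: measurable_spacing_density.
have mh : measurable_fun [set: R] h by exact: measurable_funM.
exact: (monotone_likelihood_ratio_mean (spacing_density f l u) h (c_0u f u)
  msd mh (fun z => spacing_density_ge0 _ _ _ _ f0) h0
  (fun x y => MLR_spacing_density _ _ _ _ _ f0 fmlr l0) KE K0).
Qed.

End Improvement.

(** * Integrating the comparison over the spacing *)

Section WeightedComparison.
Context {d : measure_display} {T : measurableType d} {R : realType}.
Local Notation mu := (@lebesgue_measure R).

(** This is E[w(U) (Z - s(U))] <= 0 with the two parts on opposite sides, so that both expectations
    make sense in [0, +oo]. It holds for each value of the spacing separately. *)
Lemma weighted_excess_le (f : R -> R) (P : R * R -> probability T R)
    (X1 X2 : {mfun T >-> R}) (theta : R * R) (w s : R -> R) :
    measurable_fun [set: R] f -> (forall x, 0 <= f x) ->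
    location_model f P X1 X2 -> MLR f ->
    (forall u, 0 < u -> c_0u_well_defined f u) ->
    measurable_fun [set: R] w -> measurable_fun [set: R] s ->
    (forall u, 0 <= w u) -> (forall u, w u != 0 -> s u = c_0u f u) ->
  (\int[P theta]_v (w (spacing (X1 v, X2 v)) *
     Num.max 0 (pair_max (X1 v, X2 v) - pair_max theta -
                s (spacing (X1 v, X2 v))))%:E <=
   \int[P theta]_v (w (spacing (X1 v, X2 v)) *
     Num.max 0 (s (spacing (X1 v, X2 v)) -
                (pair_max (X1 v, X2 v) - pair_max theta)))%:E)%E.
Proof.
move=> mf f0 model fmlr cwd mw ms w0 sE.
have mw2 : measurable_fun [set: R * R] (fun p => w p.2).
  exact: measurable_fun_app.
have ms2 : measurable_fun [set: R * R] (fun p => s p.2).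
  exact: measurable_fun_app.
pose k1 (p : R * R) := w p.2 * Num.max 0 (p.1 - s p.2).
pose k2 (p : R * R) := w p.2 * Num.max 0 (s p.2 - p.1).
have mk1 : measurable_fun [set: R * R] k1.
  apply: measurable_funM => //; apply: measurable_maxr => //.
  exact: measurable_funB.
have mk2 : measurable_fun [set: R * R] k2.
  apply: measurable_funM => //; apply: measurable_maxr => //.
  exact: measurable_funB.
have k10 p : 0 <= k1 p by rewrite mulr_ge0// le_max lexx.
have k20 p : 0 <= k2 p by rewrite mulr_ge0// le_max lexx.
set l := `|theta.1 - theta.2|.
have l0 : 0 <= l by exact: normr_ge0.
have sd0 u z : 0 <= spacing_density f l u z by exact: spacing_density_ge0.
have := ge0_expectation_location _ _ f P X1 X2 theta k1 mf f0 model mk1 k10.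
rewrite -/l /k1/= => ->.
have := ge0_expectation_location _ _ f P X1 X2 theta k2 mf f0 model mk2 k20.
rewrite -/l /k2/= => ->.
pose G (k : R * R -> R) (p : R * R) : \bar R :=
  if 0 < p.1 then (k (p.2, p.1) * spacing_density f l p.1 p.2)%:E else 0%E.
have mG k : measurable_fun [set: R * R] k -> measurable_fun [set: R * R] (G k).
  move=> mk; apply: measurable_if_lt => //; apply/measurable_EFinP.
  apply: measurable_funM; last exact: measurable_spacing_density.
  by apply: (measurableT_comp mk); exact: measurable_fun_pair.
have G0 k : (forall p, 0 <= k p) -> forall p, (0 <= G k p)%E.
  by move=> k0 p; rewrite /G; case: ifP => // _; rewrite lee_fin mulr_ge0.
apply: ge0_le_integral => //.
- by move=> u _; apply: integral_ge0 => z _; exact: (G0 k1 k10 (u, z)).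
- exact: (@measurable_fun_fubini_tonelli_F _ _ _ _ R mu
    (G k1) (mG k1 mk1) (G0 k1 k10)).
- exact: (@measurable_fun_fubini_tonelli_F _ _ _ _ R mu
    (G k2) (mG k2 mk2) (G0 k2 k20)).
move=> u _; have [u0|//] := ltP 0 u.
(* Where the weight is zero both sides vanish; elsewhere [s u] is the mean [c_0u f u] and
   [spacing_density_mean_le] applies. *)
have [wu0|wu0] := eqVneq (w u) 0.
  under eq_integral do rewrite wu0 !mul0r.
  by under [leRHS]eq_integral do rewrite wu0 !mul0r.
rewrite sE//.
under eq_integral do rewrite -mulrA EFinM.
under [leRHS]eq_integral do rewrite -mulrA EFinM.
have msd : measurable_fun [set: R] (spacing_density f l u).
  exact: measurable_spacing_density.
rewrite !ge0_integralZl_EFin//.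
- by rewrite lee_wpmul2l ?lee_fin//; apply: spacing_density_mean_le => //; exact: cwd.
- by move=> z _; rewrite lee_fin mulr_ge0// le_max lexx.
- apply/measurable_EFinP/measurable_funM => //.
  by apply: measurable_maxr => //; exact: measurable_funB.
- by move=> z _; rewrite lee_fin mulr_ge0// le_max lexx.
- apply/measurable_EFinP/measurable_funM => //.
  by apply: measurable_maxr => //; exact: measurable_funB.
Qed.

End WeightedComparison.

(** * Risk difference and improvement *)

Lemma risk_gap (R : realType) (d : measure_display) (T : measurableType d)
    (f : R -> R) (P : R * R -> probability T R) (X1 X2 : {mfun T >-> R})
    (theta : R * R) :
    measurable_fun [set: R] f -> (forall x, 0 <= f x) ->
    location_model f P X1 X2 ->
    (forall u : R, 0 < u -> c_0u_well_defined f u) -> MLR f ->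
    (risk P X1 X2 theta (delta_c0 f) < +oo)%E ->
    (risk P X1 X2 theta (delta_ST f) < +oo)%E ->
  (risk P X1 X2 theta (delta_ST f) +
   \int[P theta]_v
     ((c0 f - Num.min (c0 f) (c_0u f (spacing (X1 v, X2 v)))) ^+ 2)%:E <=
   risk P X1 X2 theta (delta_c0 f))%E.
Proof.
move=> mf f0 model cwd fmlr Roo Soo.
pose s u := Num.min (c0 f) (c_0u f u).
pose w u := c0 f - s u.
have ms : measurable_fun [set: R] s.
  by apply: measurable_minr => //; exact: measurable_c_0u.
have mw : measurable_fun [set: R] w by exact: measurable_funB.
have w0 u : 0 <= w u by rewrite subr_ge0 ge_min lexx.
(* The 2 of the cross term in the expanded square is put into the weight. If the minimum is [c0 f],
   the weight is zero. *)
have sE u : 2 * w u != 0 -> s u = c_0u f u.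
  apply: contraNeq; rewrite /w /s; case: leP => [_|]; rewrite ?subrr ?mulr0//.
  by rewrite eqxx.
pose X v := (X1 v, X2 v).
pose Z v := pair_max (X v) - pair_max theta.
pose U v := spacing (X v).
have mX : measurable_fun [set: T] X by exact: measurable_fun_pair.
have mZ : measurable_fun [set: T] Z.
  by apply: measurable_funB => //; exact: (measurableT_comp measurable_pair_max).
have mU : measurable_fun [set: T] U by exact: (measurableT_comp measurable_spacing).
have mwU : measurable_fun [set: T] (fun v => w (U v)) by exact: measurable_fun_app.
have msU : measurable_fun [set: T] (fun v => s (U v)) by exact: measurable_fun_app.
pose A v := (Z v - c0 f) ^+ 2.
pose B v := (Z v - s (U v)) ^+ 2.
pose p v := 2 * w (U v) * Num.max 0 (Z v - s (U v)).
pose n v := 2 * w (U v) * Num.max 0 (s (U v) - Z v).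
have mA : measurable_fun [set: T] (EFin \o A).
  by apply/measurable_EFinP/measurable_funX; exact: measurable_funB.
have mB : measurable_fun [set: T] (EFin \o B).
  by apply/measurable_EFinP/measurable_funX; exact: measurable_funB.
have mW : measurable_fun [set: T] (EFin \o (fun v => w (U v) ^+ 2)).
  by apply/measurable_EFinP/measurable_funX.
have mp : measurable_fun [set: T] (EFin \o p).
  apply/measurable_EFinP; apply: measurable_funM; first exact: measurable_funM.
  by apply: measurable_maxr => //; exact: measurable_funB.
have mn : measurable_fun [set: T] (EFin \o n).
  apply/measurable_EFinP; apply: measurable_funM; first exact: measurable_funM.
  by apply: measurable_maxr => //; exact: measurable_funB.
have A0 v : (0 <= (A v)%:E)%E by rewrite lee_fin sqr_ge0.
have B0 v : (0 <= (B v)%:E)%E by rewrite lee_fin sqr_ge0.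
have W0 v : (0 <= (w (U v) ^+ 2)%:E)%E by rewrite lee_fin sqr_ge0.
have p0 v : (0 <= (p v)%:E)%E by rewrite lee_fin !mulr_ge0// le_max lexx.
have n0 v : (0 <= (n v)%:E)%E by rewrite lee_fin !mulr_ge0// le_max lexx.
have RE : risk P X1 X2 theta (delta_c0 f) = (\int[P theta]_v (A v)%:E)%E.
  rewrite /risk unlock; apply: eq_integral => v _; congr (_ ^+ 2)%:E.
  by rewrite /delta_c0 /Z -/(X v); ring.
have SE : risk P X1 X2 theta (delta_ST f) = (\int[P theta]_v (B v)%:E)%E.
  rewrite /risk unlock; apply: eq_integral => v _; congr (_ ^+ 2)%:E.
  by rewrite /delta_ST /Z -/(X v) -/(U v) -/(s (U v)); ring.
have pn : (\int[P theta]_v (p v)%:E <= \int[P theta]_v (n v)%:E)%E.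
  apply: (weighted_excess_le f P X1 X2 theta (fun u => 2 * w u) s) => //.
  - exact: measurable_funM.
  - by move=> u; rewrite mulr_ge0.
(* Finiteness lets this term be cancelled at the end. Where [s > Z], one has
   [A + 4 B - n = w ^ 2 + 5 (s - Z) ^ 2]; elsewhere [n = 0]. Hence the two finite risks bound it. *)
have nfin : (\int[P theta]_v (n v)%:E \is a fin_num)%E.
  rewrite ge0_fin_numE; last by exact: integral_ge0.
  apply: (@le_lt_trans _ _ (\int[P theta]_v ((A v)%:E + 4%:E * (B v)%:E))%E).
    apply: ge0_le_integral => //.
    + apply: emeasurable_funD => //; exact: measurable_funeM.
    + move=> v _; rewrite -EFinM -EFinD lee_fin /n /A /B /w.
      have [sZ|Zs] := leP (s (U v) - Z v) 0.
        rewrite mulr0; apply: addr_ge0; first exact: sqr_ge0.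
        by apply: mulr_ge0; [exact: ler0n|exact: sqr_ge0].
      rewrite -subr_ge0.
      rewrite (_ : _ - _ = (s (U v) - c0 f) ^+ 2 + 5 * (s (U v) - Z v) ^+ 2).
        apply: addr_ge0; first exact: sqr_ge0.
        by apply: mulr_ge0; [exact: ler0n|exact: sqr_ge0].
      by ring.
  rewrite ge0_integralD//; last 2 first.
  - by move=> v _; rewrite mule_ge0.
  - exact: measurable_funeM.
  rewrite ge0_integralZl_EFin// -RE -SE lte_add_pinfty// lte_mul_pinfty//.
(* This is [A = B - 2 w (Z - s) + w ^ 2], rearranged so that every term is nonnegative and the
   integrals add up. *)
have key : (\int[P theta]_v (A v)%:E + \int[P theta]_v (p v)%:E =
    \int[P theta]_v (B v)%:E + \int[P theta]_v (w (U v) ^+ 2)%:E +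
    \int[P theta]_v (n v)%:E)%E.
  rewrite -!ge0_integralD//; last 2 first.
  - by move=> v _; rewrite adde_ge0.
  - exact: emeasurable_funD.
  apply: eq_integral => v _; rewrite -!EFinD; congr EFin.
  rewrite /A /B /p /n /w.
  have [sZ|Zs] := leP (s (U v)) (Z v).
    rewrite (@max_r _ _ 0) ?subr_ge0// (@max_l _ _ 0) ?subr_le0//; ring.
  rewrite (@max_l _ _ 0) ?subr_le0 ?(ltW Zs)// (@max_r _ _ 0) ?subr_ge0 ?(ltW Zs)//.
  ring.
rewrite RE SE -(leeD2rE _ _ nfin) -key.
by rewrite leeD2l.
Qed.

Theorem theorem3p1 (R : realType) (d : measure_display) (T : measurableType d)
  (f : R -> R) (P : R * R -> probability T R) (X1 X2 : {mfun T >-> R})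
  (f_density : is_density f)
  (model : location_model f P X1 X2)
  (c0_wd : c0_well_defined f)
  (c_0u_wd : forall u : R, 0 < u -> c_0u_well_defined f u)
  (risk_c0_fin : forall theta : R * R,
     (risk P X1 X2 theta (delta_c0 f) < +oo)%E)
  (risk_ST_fin : forall theta : R * R,
     (risk P X1 X2 theta (delta_ST f) < +oo)%E)
  (f_MLR : MLR f)
  (c0_gt : exists theta : R * R,
     P theta [set w | c0 f > c_0u f (spacing (X1 w, X2 w))] <> 0%E) :
  improves_upon P X1 X2 (delta_ST f) (delta_c0 f).
Proof.
have [mf f0 _] := f_density.
have gap theta := risk_gap _ _ _ _ _ _ _ theta mf f0 model c_0u_wd f_MLR
  (risk_c0_fin theta) (risk_ST_fin theta).
(* The gap term is a nonnegative expectation, which gives the weak inequality; its positivity at one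
   [theta] gives the strict one. *)
split=> [theta|].
  apply: le_trans (gap theta); rewrite leeDl//.
  by apply: integral_ge0 => v _; rewrite lee_fin sqr_ge0.
have [theta Ptheta] := c0_gt; exists theta.
apply: lt_le_trans (gap theta).
pose W v := c0 f - Num.min (c0 f) (c_0u f (spacing (X1 v, X2 v))).
have mc : measurable_fun [set: T] (fun v => c_0u f (spacing (X1 v, X2 v))).
  apply: measurable_fun_app; first exact: measurable_c_0u.
  by apply: (measurableT_comp measurable_spacing); exact: measurable_fun_pair.
have mW : measurable_fun [set: T] (fun v => (W v ^+ 2)%:E).
  apply/measurable_EFinP/measurable_funX/measurable_funB => //.
  exact: measurable_minr.
(* Adding a positive quantity increases the risk strictly because the risk is finite. *)
rewrite lteDl; last first.
  rewrite ge0_fin_numE//; rewrite /risk unlock.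
  by apply: integral_ge0 => v _; rewrite lee_fin sqr_ge0.
rewrite lt_neqAle integral_ge0 ?andbT; last first.
  by move=> v _; rewrite lee_fin sqr_ge0.
(* If the second moment of [W] vanished, [W] would be zero almost surely; but [W > 0] on the event
   where [c0 f] exceeds [c_0u f] at the spacing, so that event would be null. *)
apply/negP => /eqP W0; apply: Ptheta.
have : (\int[P theta]_v `|(W v ^+ 2)%:E| = 0)%E.
  by rewrite [RHS]W0; apply: eq_integral => v _; rewrite gee0_abs// lee_fin sqr_ge0.
move/(ae_eq_integral_abs (P theta) measurableT mW) => ae0.
have mS : measurable [set v | c_0u f (spacing (X1 v, X2 v)) < c0 f].
  rewrite -[X in measurable X]setTI.
  by have := measurable_fun_ltr mc (measurable_cst (c0 f)) measurableT; apply.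
apply: measure_negligible => //; apply: negligibleS ae0 => v /= cv /(_ I) /eqP.
by rewrite eqe sqrf_eq0 subr_eq0 /W min_r ?(ltW cv)// gt_eqF.
Qed.
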